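(* Let $H=\ell^2(\mathbb{N})$ (real), let $p>0$ be a real number, and let $(\alpha_n)_{n\in\mathbb{N}}$ be a sequence of strictly positive real numbers such that $$\alpha_n\to0,\qquad\sum_{n=0}^\infty\alpha_n^{2p-2}<+\infty\qquad\text{and}\qquad\sum_{n=0}^\infty\alpha_n^{2p-4}=+\infty.$$ Set $U=\{x=(x_n)_{n\in\mathbb{N}}\in H: x_{2n+1}=-\alpha_nx_{2n}\text{ for all }n\in\mathbb{N}\}$ and $V=\{x=(x_n)_{n\in\mathbb{N}}\in H: x_{2n}=0\text{ for all }n\in\mathbb{N}\}$, and let $A=N_U$ and $B=P_V$. Set $D:=\operatorname{dom}A-\operatorname{dom}B$ and $R:=\operatorname{ran}A+\operatorname{ran}B$. Then $P_V(U^\perp)\setminus P_V(U)\neq\varnothing$, and hence $$\operatorname{ran}(\mathrm{Id}-T_{(A,B)})\subsetneqq D\cap R\qquad\text{and}\qquad\operatorname{ran}(A+B)\subsetneqq\operatorname{ran}A+\operatorname{ran}B.$$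
   Context: $\mathbb{N}=\{0,1,2,\dots\}$. $N_U$ is the normal cone operator of the closed subspace $U$ (so $N_U(x)=U^\perp$ for $x\in U$ and $N_U(x)=\varnothing$ otherwise), and $P_V$ is the orthogonal projector onto $V$. For a maximally monotone operator $A$ on $H$, $J_A=(\mathrm{Id}+A)^{-1}$ and $R_A=2J_A-\mathrm{Id}$. The Douglas--Rachford operator of the ordered pair $(A,B)$ of maximally monotone operators is $T_{(A,B)}:=\tfrac12\mathrm{Id}+\tfrac12R_BR_A=\mathrm{Id}-J_A+J_BR_A$. Sums and differences of sets are Minkowski sums and differences. *)

(* Defs.v *)
From HB Require Import structures.
From mathcomp Require Import all_boot all_order all_algebra sesquilinear.
From mathcomp Require Import all_classical all_reals all_analysis.

Set Implicit Arguments.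
Unset Strict Implicit.
Unset Printing Implicit Defensive.

Import Order.TTheory GRing.Theory Num.Theory.
Import numFieldNormedType.Exports.

Local Open Scope classical_set_scope.
Local Open Scope ring_scope.

(* A set-valued operator on V is a map V -> set V; a single-valued operator is
   one whose values are singletons, and a value set0 means that the point is
   outside the domain. *)
Section Operators.
Context {R : realType} {V : lmodType R}.
Implicit Types (C D : set V) (A B : V -> set V) (c : R) (x : V).

Definition mink_add C D : set V := [set u + v | u in C & v in D].
Definition mink_sub C D : set V := [set u - v | u in C & v in D].

Definition op_dom A : set V := [set x | A x !=set0].
Definition op_ran A : set V := \bigcup_x A x.
Definition op_image A C : set V := \bigcup_(x in C) A x.

Definition op_id : V -> set V := fun x => [set x].
Definition op_inv A : V -> set V := fun x => [set y | A y x].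
Definition op_comp A B : V -> set V := fun x => op_image A (B x).
Definition op_scale c A : V -> set V := fun x => [set c *: u | u in A x].
Definition op_add A B : V -> set V := fun x => mink_add (A x) (B x).
Definition op_sub A B : V -> set V := fun x => mink_sub (A x) (B x).

Definition resolvent A : V -> set V := op_inv (op_add op_id A).
Definition reflected_resolvent A : V -> set V :=
  op_sub (op_scale 2 (resolvent A)) op_id.

Definition DouglasRachford A B : V -> set V :=
  op_add (op_scale 2^-1 op_id)
    (op_scale 2^-1 (op_comp (reflected_resolvent B) (reflected_resolvent A))).

End Operators.

Section InnerProduct.
Context {R : realType} {V : lmodType R} (ip : {dot V for idfun}).
Implicit Types (C : set V) (x : V).

Definition ortho_compl C : set V := [set u | forall w, C w -> ip u w = 0].

Definition normal_cone C : V -> set V :=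
  fun x => [set u | C x /\ forall y, C y -> ip (y - x) u <= 0].

(* The orthogonal projector, given by its graph: v is the projection of x onto
   the subspace C when v is in C and x - v is orthogonal to C. *)
Definition ortho_proj C : V -> set V :=
  fun x => [set v | C v /\ ortho_compl C (x - v)].

Lemma normal_cone_subspace C x :
  (forall c u v, C u -> C v -> C (c *: u + v)) -> C x ->
  normal_cone C x = ortho_compl C.
Proof.
move=> CL Cx; apply/seteqP; split => u /=.
  move=> [_ Nu] w Cw.
  have Nw c : c * ip w u <= 0.
    by rewrite -linearZl_LR -[c *: w](addrK x); apply: Nu; exact: CL.
  rewrite hermC expr0 mul1r /=; apply: le_anti.
  by rewrite -[X in X <= _]mul1r Nw -oppr_le0 -mulN1r Nw.
move=> Nu; split=> // y Cy.
by rewrite hermC expr0 mul1r /= Nu // -scaleN1r addrC; exact: CL.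
Qed.

End InnerProduct.

(* l^2 is L^2 for the counting measure on nat (see ell2P); as the only null set
   is empty, no quotient is needed. *)
Notation ell2 R := (LfunType (@counting nat R) (lee1n 2)).

Section Ell2.
Context {R : realType}.
Implicit Types (x y z : ell2 R).

Lemma ell2P (x : R^nat) :
  x \in Lfun (@counting nat R) 2%:E <-> cvgn (series (fun n => x n ^+ 2)).
Proof.
split=> [/Lfun2_integrable_sqr /integrableP[_] | xcvg].
  rewrite ge0_integral_count// => xoo.
  apply: (@summable_cvg R xpredT (fun n => (x n ^+ 2)%:E)).
    by move=> n _; rewrite lee_fin sqr_ge0.
  by rewrite /summable -nneseries_esum.
rewrite inE; apply/andP; split; rewrite inE //= /finite_norm.
rewrite Lnorm_counting// poweR_lty//.
rewrite (@eq_eseriesr _ _ (fun n => (x n ^+ 2)%:E)); last first.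
  by move=> n _; rewrite /= -[2%R]/(2%:R) powR_mulrn// real_normK ?num_real.
rewrite [ltLHS](_ : _ = (limn (series (fun n => x n ^+ 2)))%:E) ?ltry//.
rewrite -EFin_lim//; congr (limn _); apply/funext => n /=.
by rewrite seriesEnat /= sumEFin.
Qed.

Definition ell2_dot x y : R := limn (series (fun n => x n * y n)).

Lemma is_cvg_ell2_dot x y : cvgn (series (fun n => x n * y n)).
Proof.
apply: normed_cvg.
have /Lfun1_integrable := Lfun2_mul_Lfun1 (LfunP x) (LfunP y).
move=> /integrableP[_]; rewrite ge0_integral_count// => xyoo.
apply: (@summable_cvg R xpredT (fun n => `|(x n * y n)%:E|%E)) => //.
rewrite /summable -nneseries_esum//.
by under eq_eseriesr do rewrite abse_id.
Qed.

Let ell2_dotC x y : ell2_dot x y = ell2_dot y x.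
Proof.
by congr (limn (series _)); apply/funext => n; rewrite mulrC.
Qed.

Let ell2_dotDr x : {morph ell2_dot x : y z / y + z}.
Proof.
move=> y z; rewrite /ell2_dot -lim_seriesD; [|exact: is_cvg_ell2_dot..].
by congr (limn (series _)); apply/funext => n; rewrite -mulrDr.
Qed.

Let ell2_dotZr x c y : ell2_dot x (c *: y) = c * ell2_dot x y.
Proof.
rewrite /ell2_dot -[c * _]lim_seriesZ; last exact: is_cvg_ell2_dot.
by congr (limn (series _)); apply/funext => n; rewrite /= mulrCA.
Qed.

Let ell2_dotBr x : zmod_morphism (ell2_dot x).
Proof.
by move=> y z; rewrite ell2_dotDr -scaleN1r ell2_dotZr mulN1r.
Qed.

Let ell2_dotBl y : zmod_morphism (ell2_dot^~ y).
Proof. by move=> x z; rewrite !(ell2_dotC _ y) ell2_dotBr. Qed.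

Let ell2_dotZl y : scalable_for *%R (ell2_dot^~ y).
Proof. by move=> c x; rewrite !(ell2_dotC _ y) ell2_dotZr. Qed.

HB.instance Definition _ := @isBilinear.Build R (ell2 R) (ell2 R) R
  *%R (idfun \; *%R) ell2_dot ell2_dotBl ell2_dotBr ell2_dotZl ell2_dotZr.

Let ell2_dot_sym x y : ell2_dot x y = (-1) ^+ false * idfun (ell2_dot y x).
Proof. by rewrite expr0 mul1r; exact: ell2_dotC. Qed.

HB.instance Definition _ := @isHermitianSesquilinear.Build R (ell2 R)
  false idfun ell2_dot ell2_dot_sym.

Let ell2_dot_gt0 x : x != 0 -> 0 < ell2_dot x x.
Proof.
move=> /eqP x0.
have [k xk] : exists k, x k != 0.
  apply: contra_notP x0 => /forallNP x0.
  by apply/LfuneqP => n; apply/eqP; apply: contra_notT (x0 n).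
have ndx : nondecreasing_seq (series (fun n => x n * x n)).
  by apply/nondecreasing_series => n _ _; rewrite -expr2 sqr_ge0.
apply: lt_le_trans (nondecreasing_cvgn_le ndx (is_cvg_ell2_dot (x:=x) (y:=x)) k.+1).
rewrite seriesEnat /= big_nat_recr //= ltr_wpDl ?sumr_ge0//.
  by move=> i _; rewrite -expr2 sqr_ge0.
by rewrite -expr2 lt_neqAle eq_sym sqrf_eq0 xk sqr_ge0.
Qed.

HB.instance Definition _ :=
  @isDotProduct.Build R (ell2 R) ell2_dot ell2_dot_gt0.

End Ell2.

(* Main.v *)
Require Import Defs.
From mathcomp Require Import all_boot all_order all_algebra.
From mathcomp Require Import all_classical all_reals all_analysis.
From mathcomp Require Import sesquilinear lra.

Import Order.TTheory GRing.Theory Num.Theory.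
Import numFieldNormedType.Exports.

Local Open Scope classical_set_scope.
Local Open Scope ring_scope.

(** The statement is driven by one abstract fact about subspaces [U] and [V] of
    an inner product space with [V `&` U^perp = 0], for [A = N_U] and [B = P_V]:
    a point of [V] that belongs to [ran (A + B)] or to [ran (Id - T)] must belong
    to [P_V(U)].

    For [A + B] this is immediate: a point of the range is [n + P_V a] with [a]
    in [U] and [n] in [U^perp]; if it lies in [V], so does [n], whence [n = 0].
    For [Id - T], let [a = J_A x] and [b = J_B (R_A x)].  The displacement [z] of
    [x] is at once the difference [a - b] of points of the domains and the sum
    [n + c] of the values [n] in [A a] and [c] in [B b] that witness the two
    resolvents (ran_id_sub_DR).  When [z] is in [V], again [n = 0], so
    [z = P_V b = P_V a - z], and [z] is the projection of [a / 2].

    On the other hand every point of [V] lies in both of the larger sets: it and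
    its opposite are their own projections, and 0 is in [A 0].  So both
    inclusions are strict as soon as some point of [V] escapes [P_V(U)]
    (ran_inclusions_strict).

    For the subspaces of the square summable sequences at hand, everything is
    read off coordinates.  The complement [U^perp] consists of the [u] with
    [u_(2n) = alpha_n u_(2n+1)], so it meets [V] only at 0, and, [alpha] being
    bounded, [P_V(U^perp)] is all of [V].  A point of [V] with odd entries [w] is
    in [P_V(U)] exactly when [w / alpha] is square summable.  The sequence
    [w_n = alpha_n ^ (p - 1)] is square summable while [w / alpha] is not: these
    are the two hypotheses on the series. *)

(** * Ranges of the displacement operator and of the sum *)

Section OperatorRanges.
Context {R : realType} {V : lmodType R}.
Implicit Types (A B : V -> set V).

(** Here [a = J_A x] and [b = J_B (R_A x)] with [R_A x = 2 a - x]; then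
    [R_B (R_A x) = 2 b - 2 a + x], so that [x - T x = a - b].  The inclusions
    [x - a \in A a] and [2 a - x - b \in B b] give [n] and [c], which add up to
    [a - b] too. *)
Lemma ran_id_sub_DR A B z :
  op_ran (op_sub op_id (DouglasRachford A B)) z ->
  exists a b n c, [/\ A a n, B b c, z = a - b & z = n + c].
Proof.
move=> [x _ [_ -> [_ [_ [_ -> <-]] [_ [s [r rP sP] <-] <-] <-]]].
case: rP => _ [a [_ -> [n An xE]] <-] [_ -> rE].
case: sP => _ [b [_ -> [c Bc rE']] <-] [_ -> sE].
(* Membership in a singleton or a preimage is an equation up to conversion. *)
have {}xE : a + n = x by [].
have {}rE : 2 *: a - x = r by [].
have {}rE' : b + c = r by [].
have {}sE : 2 *: b - r = s by [].
have xsE : x + s = 2 *: (x - (a - b)).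
  rewrite -sE -rE !scalerBr !opprB !scaler_nat !mulr2n -[in RHS]addrA.
  by congr (_ + _); rewrite addrCA.
have zE : x - (2^-1 *: x + 2^-1 *: s) = a - b.
  by rewrite -scalerDr xsE scalerA mulVf ?pnatr_eq0// scale1r subKr.
exists a, b, n, c; split=> //; rewrite zE.
have -> : a = b + c + n.
  by rewrite rE' -rE -xE scaler_nat mulr2n opprD addrA addrK subrK.
by rewrite addrAC (addrAC b c) subrr add0r addrC.
Qed.

Lemma ran_op_add_subset A B :
  op_ran (op_add A B) `<=` mink_add (op_ran A) (op_ran B).
Proof.
move=> _ [x _ [u Au [v Bv <-]]].
by exists u; [exists x | exists v => //; exists x].
Qed.

Lemma ran_id_sub_DR_subset A B :
  op_ran (op_sub op_id (DouglasRachford A B)) `<=`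
  mink_sub (op_dom A) (op_dom B) `&` mink_add (op_ran A) (op_ran B).
Proof.
move=> z /ran_id_sub_DR[a [b [n [c [An Bc zab znc]]]]]; split.
  by exists a; [exists n | exists b; [exists c | ]].
by exists n; [exists a | exists c; [exists b | ]].
Qed.

End OperatorRanges.

(** * Normal cone and projector of two subspaces *)

Section SubspacePair.
Context {R : realType} {H : lmodType R} (ip : {dot H for idfun}).
Context (U V : set H).
Hypothesis U_lin : forall c u v, U u -> U v -> U (c *: u + v).
Hypothesis V_lin : forall c u v, V u -> V v -> V (c *: u + v).
Hypothesis V_cap_perpU : V `&` ortho_compl ip U `<=` [set 0].

Local Notation A := (normal_cone ip U).
Local Notation P_V := (ortho_proj ip V).
Local Notation perpU := (ortho_compl ip U).

Lemma normal_cone_sub_ortho_compl x u : A x u -> perpU u.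
Proof.
by move=> Au; have [Ux _] := Au; rewrite -(normal_cone_subspace ip U_lin Ux).
Qed.

(** In [v = n + c] with [c] in [V], the normal vector [n] is in [V] as well, so
    it vanishes. *)
Lemma ran_op_add_ortho_proj v :
  V v -> op_ran (op_add A P_V) v -> op_image P_V U v.
Proof.
move=> Vv [a _ [n An [c [Vc ac] ncv]]].
have n0 : n = 0.
  apply: V_cap_perpU; split; last exact: normal_cone_sub_ortho_compl An.
  by rewrite -(addrK c n) ncv addrC -scaleN1r; exact: V_lin.
exists a; first by case: An.
by rewrite -ncv n0 add0r; split.
Qed.

(** As above [v = c = P_V b], where now [b = a - v]; hence [P_V a = 2 v] and [v]
    is the projection of [a / 2]. *)
Lemma ran_id_sub_DR_ortho_proj v : V v ->
  op_ran (op_sub op_id (DouglasRachford A P_V)) v -> op_image P_V U v.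
Proof.
move=> Vv /ran_id_sub_DR[a [b [n [c [An [Vc bc] vab vnc]]]]].
have n0 : n = 0.
  apply: V_cap_perpU; split; last exact: normal_cone_sub_ortho_compl An.
  by rewrite -(addrK c n) -vnc addrC -scaleN1r; exact: V_lin.
have [Ua _] := An.
have cv : c = v by rewrite vnc n0 add0r.
exists (2^-1 *: a).
  have U0 : U 0 by rewrite -(addNr a) -scaleN1r; exact: U_lin.
  by rewrite -[_ *: a]addr0; exact: U_lin.
split=> // w Vw.
have -> : 2^-1 *: a - v = 2^-1 *: (b - c).
  have -> : b - c = a - 2 *: v.
    by rewrite cv scaler_nat mulr2n opprD addrA {2}vab subKr.
  by rewrite scalerBr scalerA mulVf ?pnatr_eq0// scale1r.
by rewrite linearZl_LR /= bc// mulr0.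
Qed.

(** The witness of strictness is the same in both cases: a point [v] of
    [P_V(U^perp)], hence of [V], outside [P_V(U)]. *)
Lemma ran_inclusions_strict : U 0 ->
  op_image P_V perpU `\` op_image P_V U !=set0 ->
  op_ran (op_sub op_id (DouglasRachford A P_V)) `<`
    mink_sub (op_dom A) (op_dom P_V) `&` mink_add (op_ran A) (op_ran P_V) /\
  op_ran (op_add A P_V) `<` mink_add (op_ran A) (op_ran P_V).
Proof.
move=> U0 [v [[u _ [Vv _]] notPU]].
have P_Vid x : V x -> P_V x x.
  by move=> Vx; split=> // w _; rewrite subrr linear0l.
have A00 : A 0 0 by split=> // y _; rewrite linear0.
have vR : mink_add (op_ran A) (op_ran P_V) v.
  exists 0; first by exists 0.
  by exists v; [exists v => //; exact: P_Vid | rewrite add0r].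
have VN : V (- v).
  have V0 : V 0 by rewrite -(addNr v) -scaleN1r; exact: V_lin.
  by rewrite -[- v]addr0 -scaleN1r; exact: V_lin.
split; split.
- exact: ran_id_sub_DR_subset.
- move=> /(_ v) vran; apply: notPU; apply: ran_id_sub_DR_ortho_proj => //.
  apply: vran; split=> //.
  (* v = 0 - (- v), with 0 in the domain of N_U and - v in that of P_V *)
  exists 0; first by exists 0.
  by exists (- v); [exists (- v); exact: P_Vid | rewrite sub0r opprK].
- exact: ran_op_add_subset.
- move=> /(_ v) vran; apply: notPU; apply: ran_op_add_ortho_proj => //.
  exact: vran.
Qed.

End SubspacePair.

(** * Square summable sequences as pairs of even and odd entries *)

Section SquareSummable.
Context {R : realType}.
Implicit Types (f g : R^nat) (x y : ell2 R).

Lemma nneseries_lty_bounded f : (forall n, 0 <= f n) ->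
  (\sum_(0 <= n <oo) (f n)%:E < +oo)%E <-> exists M, forall n, series f n <= M.
Proof.
move=> f0; split=> [foo|[M fM]].
  have fin : (\sum_(0 <= n <oo) (f n)%:E)%E \is a fin_num.
    by rewrite ge0_fin_numE// nneseries_ge0// => n _ _; rewrite lee_fin.
  exists (fine (\sum_(0 <= n <oo) (f n)%:E)%E) => n.
  rewrite -lee_fin fineK// seriesEnat /= -sumEFin.
  by apply: nneseries_lim_ge => k _ _; rewrite lee_fin.
apply: (@le_lt_trans _ _ M%:E); last exact: ltry.
apply: lime_le; first by apply: is_cvg_nneseries => n _ _; rewrite lee_fin.
by apply: nearW => n; rewrite sumEFin lee_fin; move: (fM n); rewrite seriesEnat.
Qed.

(** Bounded partial sums are the most convenient form of square summability
    here, because splitting a sequence into its even and odd entries amounts to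
    regrouping partial sums. *)
Lemma Lfun2_boundedP f :
  f \in Lfun (@counting nat R) 2%:E <->
  exists M, forall n, series (fun k => f k ^+ 2) n <= M.
Proof.
have nd : nondecreasing_seq (series (fun k => f k ^+ 2)).
  by apply/nondecreasing_series => n _ _; exact: sqr_ge0.
rewrite ell2P; split=> [cf|[M fM]].
  exists (limn (series (fun k => f k ^+ 2))) => n.
  exact: nondecreasing_cvgn_le.
by apply: nondecreasing_is_cvgn => //; exists M => _ [n _ <-].
Qed.

Lemma Lfun2_nneseriesP f :
  f \in Lfun (@counting nat R) 2%:E <->
  (\sum_(0 <= n <oo) (f n ^+ 2)%:E < +oo)%E.
Proof.
rewrite Lfun2_boundedP nneseries_lty_bounded// => n; exact: sqr_ge0.
Qed.

Definition interleave f g : R^nat := fun k => if odd k then g k./2 else f k./2.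

Lemma interleave_even f g n : interleave f g n.*2 = f n.
Proof. by rewrite /interleave odd_double doubleK. Qed.

Lemma interleave_odd f g n : interleave f g n.*2.+1 = g n.
Proof. by rewrite /interleave /= odd_double /= uphalf_double. Qed.

Lemma series_double f n :
  series f n.*2 = series (fun k => f k.*2 + f k.*2.+1) n.
Proof.
elim: n => [|n IHn]; first by rewrite /series /= !big_geq.
by rewrite doubleS !seriesSr IHn addrA.
Qed.

Lemma ell2_even x : (fun n => x n.*2) \in Lfun (@counting nat R) 2%:E.
Proof.
have /Lfun2_boundedP[M xM] := LfunP x.
apply/Lfun2_boundedP; exists M => n; apply: le_trans (xM n.*2).
rewrite series_double !seriesEnat /=.
by apply: ler_sum => k _; rewrite lerDl sqr_ge0.
Qed.

Lemma Lfun_interleave f g :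
  f \in Lfun (@counting nat R) 2%:E -> g \in Lfun (@counting nat R) 2%:E ->
  interleave f g \in Lfun (@counting nat R) 2%:E.
Proof.
move=> /Lfun2_boundedP[M fM] /Lfun2_boundedP[N gN].
apply/Lfun2_boundedP; exists (M + N) => n.
apply: (@le_trans _ _ (series (fun k => interleave f g k ^+ 2) n.*2)).
  have nd : nondecreasing_seq (series (fun k => interleave f g k ^+ 2)).
    by apply/nondecreasing_series => k _ _; exact: sqr_ge0.
  by apply: nd; rewrite -addnn leq_addr.
rewrite series_double.
under [X in series X _]funext do rewrite interleave_even interleave_odd.
rewrite seriesEnat /= big_split /=.
by rewrite lerD//; move: (fM n) (gN n); rewrite !seriesEnat.
Qed.

Lemma Lfun_mul_bounded f g : bounded_fun f ->
  g \in Lfun (@counting nat R) 2%:E ->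
  f \* g \in Lfun (@counting nat R) 2%:E.
Proof.
move=> [M0 [_ fM0]] /Lfun2_boundedP[N gN].
have [M fM] : exists M, forall n, `|f n| <= M.
  by exists (M0 + 1) => n; apply: fM0 => //; rewrite ltrDl.
apply/Lfun2_boundedP; exists (M ^+ 2 * N) => n.
apply: le_trans (ler_wpM2l (sqr_ge0 M) (gN n)).
rewrite !seriesEnat /= mulr_sumr; apply: ler_sum => k _.
rewrite exprMn ler_wpM2r ?sqr_ge0// -[leLHS]real_normK ?num_real//.
by rewrite lerXn2r ?nnegrE// (le_trans _ (fM k)).
Qed.

(** The pairwise grouped series is a subsequence of the partial sums of the inner
    product.  It suits both subspaces, whose defining equations relate the
    entries [2n] and [2n+1] only. *)
Lemma cvg_ell2_dot_pairs x y :
  series (fun n => x n.*2 * y n.*2 + x n.*2.+1 * y n.*2.+1) k @[k --> \oo]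
    --> ell2_dot x y.
Proof.
have cxy : series (fun k => x k * y k) n @[n --> \oo] --> ell2_dot x y.
  exact: is_cvg_ell2_dot.
under eq_fun do rewrite -(series_double (fun n => x n * y n)) -muln2.
exact: cvg_comp (cvg_mulnr 2 isT) cxy.
Qed.

Lemma ell2_dot_pairs0 x y :
  (forall n, x n.*2 * y n.*2 + x n.*2.+1 * y n.*2.+1 = 0) -> ell2_dot x y = 0.
Proof.
move=> xy0; rewrite -(cvg_lim _ (cvg_ell2_dot_pairs x y))//.
apply: lim_near_cst => //; near=> m.
by rewrite seriesEnat /= big1.
Unshelve. all: by end_near.
Qed.

(** Such test vectors turn an orthogonality condition into the equations that it
    imposes on each pair of entries. *)
Lemma ell2_dot_single_pair (n : nat) (a b : R) : exists y : ell2 R,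
  [/\ forall k, y k.*2 = (k == n)%:R * a,
      forall k, y k.*2.+1 = (k == n)%:R * b &
      forall x, ell2_dot x y = x n.*2 * a + x n.*2.+1 * b].
Proof.
have single c : (fun k => (k == n)%:R * c) \in Lfun (@counting nat R) 2%:E.
  apply/Lfun2_boundedP; exists (c ^+ 2) => m; rewrite seriesEnat /= big_mkord.
  apply: (@le_trans _ _ (\sum_(k < m | k == n :> nat) c ^+ 2)).
    rewrite [leRHS]big_mkcond; apply: ler_sum => k _.
    by case: eqP; rewrite ?mul1r ?mul0r ?expr0n.
  case: (ltnP n m) => nm; last first.
    by rewrite big_pred0 ?sqr_ge0// => k; rewrite ltn_eqF// (leq_trans _ nm).
  by rewrite (big_pred1 (Ordinal nm)).
have := Lfun_valP (lee1n 2) (Lfun_interleave _ _ (single a) (single b)).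
move: (Lfun_Sub _ _) => y yE.
have ye k : y k.*2 = (k == n)%:R * a by rewrite yE interleave_even.
have yo k : y k.*2.+1 = (k == n)%:R * b by rewrite yE interleave_odd.
exists y; split=> // x.
rewrite -(cvg_lim _ (cvg_ell2_dot_pairs x y))//.
apply: lim_near_cst => //; near=> m.
have nm : (n < m)%N by near: m; exact: nbhs_infty_gt.
rewrite seriesEnat /= big_mkord (bigD1 (Ordinal nm))//= big1 ?addr0.
  by rewrite ye yo eqxx !mul1r.
move=> k; rewrite -val_eqE /= => /negbTE kn.
by rewrite ye yo kn !mul0r !mulr0 addr0.
Unshelve. all: by end_near.
Qed.

End SquareSummable.

(** * The two subspaces *)

Section Subspaces.
Context {R : realType}.
Implicit Types (alpha : R^nat) (x u : ell2 R).

Definition oddgraph alpha : set (ell2 R) :=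
  [set x | forall n, x n.*2.+1 = - alpha n * x n.*2].

Definition oddsupp : set (ell2 R) := [set x | forall n, x n.*2 = 0].

Lemma oddgraph_lin alpha c x u :
  oddgraph alpha x -> oddgraph alpha u -> oddgraph alpha (c *: x + u).
Proof.
move=> xU uU n.
have cxuE k : (c *: x + u) k = c * x k + u k by [].
by rewrite !cxuE xU uU mulrDr [in RHS]mulrCA.
Qed.

Lemma oddsupp_lin c x u : oddsupp x -> oddsupp u -> oddsupp (c *: x + u).
Proof.
move=> xV uV n.
have cxuE k : (c *: x + u) k = c * x k + u k by [].
by rewrite cxuE xV uV mulr0 addr0.
Qed.

(** The test vector has entries [(1, - alpha n)] at the pair [n], which spans the
    restriction of the subspace to that pair. *)
Lemma ortho_compl_oddgraph alpha u :
  ortho_compl ell2_dot (oddgraph alpha) u <->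
  forall n, u n.*2 = alpha n * u n.*2.+1.
Proof.
split=> [uU n|uE x xU].
  have [y [ye yo yE]] := ell2_dot_single_pair n 1 (- alpha n).
  have yU : oddgraph alpha y.
    move=> k; rewrite ye yo; case: eqP => [->|_].
      by rewrite mul1r !mulr1.
    by rewrite !mul0r mulr0.
  have /eqP := uU y yU; rewrite [X in X == _]yE mulr1 mulrN subr_eq0 => /eqP ->.
  by rewrite mulrC.
apply: ell2_dot_pairs0 => n.
by rewrite xU uE mulNr mulrN mulrCA !mulrA subrr.
Qed.

Lemma ortho_compl_oddsupp u :
  ortho_compl ell2_dot oddsupp u <-> forall n, u n.*2.+1 = 0.
Proof.
split=> [uV n|uE x xV].
  have [y [ye yo yE]] := ell2_dot_single_pair n (0 : R) 1.
  have yV : oddsupp y by move=> k; rewrite ye mulr0.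
  by have := uV y yV; rewrite [X in X = _]yE mulr0 add0r mulr1.
by apply: ell2_dot_pairs0 => n; rewrite xV uE mulr0 mul0r addr0.
Qed.

Lemma oddsupp_cap_ortho_compl_oddgraph alpha : (forall n, alpha n != 0) ->
  oddsupp `&` ortho_compl ell2_dot (oddgraph alpha) `<=` [set 0].
Proof.
move=> alpha0 u [uV /ortho_compl_oddgraph uU]; apply/LfuneqP => k.
rewrite -[k]odd_double_half; case: (odd k); last exact: uV.
apply: (mulfI (alpha0 k./2)).
by rewrite -uU uV mulr0.
Qed.

Lemma ortho_proj_oddsupp x v :
  ortho_proj ell2_dot oddsupp x v <->
  oddsupp v /\ forall n, v n.*2.+1 = x n.*2.+1.
Proof.
split=> [[Vv /ortho_compl_oddsupp xv]|[Vv xv]]; split=> //.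
  by move=> n; apply/eqP; rewrite eq_sym -subr_eq0; apply/eqP/xv.
by apply/ortho_compl_oddsupp => n; rewrite -[LHS]/(x _ - v _) xv subrr.
Qed.

(** The odd entries [w] extend to a vector of the orthogonal complement through
    the even entries [alpha w], which are square summable, but to a vector of the
    subspace itself only through the even entries [- w / alpha]. *)
Lemma ortho_proj_diff_nonempty alpha w :
  bounded_fun alpha -> (forall n, alpha n != 0) ->
  w \in Lfun (@counting nat R) 2%:E ->
  ~ ((fun n => w n / alpha n) \in Lfun (@counting nat R) 2%:E) ->
  op_image (ortho_proj ell2_dot oddsupp)
      (ortho_compl ell2_dot (oddgraph alpha)) `\`
    op_image (ortho_proj ell2_dot oddsupp) (oddgraph alpha) !=set0.
Proof.
move=> alpha_bounded alpha_neq0 w_l2 walpha_notl2.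
have alphaw_l2 := Lfun_mul_bounded _ _ alpha_bounded w_l2.
have zero_l2 : (fun=> 0) \in Lfun (@counting nat R) 2%:E.
  exact: LfunP (0 : ell2 R).
have := Lfun_valP (lee1n 2) (Lfun_interleave _ _ alphaw_l2 w_l2).
move: (Lfun_Sub _ _) => u uE.
have := Lfun_valP (lee1n 2) (Lfun_interleave _ _ zero_l2 w_l2).
move: (Lfun_Sub _ _) => v vE.
exists v; split.
  exists u.
    apply/ortho_compl_oddgraph => n.
    by rewrite uE interleave_even interleave_odd.
  apply/ortho_proj_oddsupp; split=> n; first by rewrite vE interleave_even.
  by rewrite vE uE !interleave_odd.
move=> [x xU /ortho_proj_oddsupp[_ vx]]; apply: walpha_notl2.
rewrite (_ : (fun _ => _) = fun n => (- x) n.*2); first exact: ell2_even.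
apply/funext => n; rewrite -[RHS]/(- x n.*2).
have <- : v n.*2.+1 = w n by rewrite vE interleave_odd.
by rewrite vx xU mulNr mulrC mulrN mulKf.
Qed.

End Subspaces.

Theorem proposition7p4 (R : realType) (p : R) (alpha : R^nat)
    (p_gt0 : 0 < p) (alpha_gt0 : forall n, 0 < alpha n)
    (alpha_cvg0 : alpha n @[n --> \oo] --> 0)
    (sum_fin : (\sum_(0 <= n <oo) (alpha n `^ (2 * p - 2))%:E < +oo)%E)
    (sum_inf : (\sum_(0 <= n <oo) (alpha n `^ (2 * p - 4))%:E = +oo)%E) :
  let U := [set x : ell2 R | forall n, x n.*2.+1 = - alpha n * x n.*2] in
  let V := [set x : ell2 R | forall n, x n.*2 = 0] in
  let P_V := ortho_proj ell2_dot V in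
  let A := normal_cone ell2_dot U in
  let B := P_V in
  let D := mink_sub (op_dom A) (op_dom B) in
  let Rg := mink_add (op_ran A) (op_ran B) in
  [/\ op_image P_V (ortho_compl ell2_dot U) `\` op_image P_V U !=set0,
      op_ran (op_sub op_id (DouglasRachford A B)) `<` D `&` Rg
    & op_ran (op_add A B) `<` mink_add (op_ran A) (op_ran B)].
Proof.
move=> U V P_V A B D Rg.
have alpha_neq0 n : alpha n != 0 by rewrite gt_eqF.
have alpha_bounded : bounded_fun alpha.
  by apply: cvg_seq_bounded; apply/cvg_ex; exists 0.
(* This rewrites the terms of both series as squares. *)
have powR2 n q : alpha n `^ (2 * q) = (alpha n `^ q) ^+ 2.
  by rewrite mulrC powRrM -powR_mulrn ?powR_ge0.
have diff : op_image P_V (ortho_compl ell2_dot U) `\` op_image P_V U !=set0.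
  apply: (@ortho_proj_diff_nonempty _ _ (fun n => alpha n `^ (p - 1))) => //.
    apply/Lfun2_nneseriesP.
    by under eq_eseriesr do rewrite -powR2 mulrBr mulr1.
  move=> /Lfun2_nneseriesP.
  have powE n : (alpha n `^ (p - 1) / alpha n) ^+ 2 = alpha n `^ (2 * p - 4).
    rewrite -{2}[alpha n]powRr1 ?ltW// -powRB ?alpha_neq0 ?implybT//.
    by rewrite -powR2; congr (_ `^ _); lra.
  by under eq_eseriesr do rewrite powE; rewrite sum_inf.
have U0 : U 0 by move=> n; rewrite mulr0.
have V_cap_perpU : V `&` ortho_compl ell2_dot U `<=` [set 0].
  exact: oddsupp_cap_ortho_compl_oddgraph.
have [ranT ranAB] := ran_inclusions_strict _ _ _
  (oddgraph_lin alpha) oddsupp_lin V_cap_perpU U0 diff.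
by split.
Qed.
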